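(* Let $Y$ be a semitopological semilattice satisfying the separation axiom $\vec{T}_{2\delta}$, and let $X$ be a complete subsemilattice of $Y$. Then the partial order $P:=\{(x,y)\in X\times X: xy=x\}$ of $X$ is closed in $Y\times Y$ (with the product topology), and the semilattice $X$ is closed in $Y$.
   Context: A semilattice is a commutative semigroup all of whose elements are idempotents ($xx=x$). It carries the natural partial order $x\le y$ iff $xy=x$ $(=yx)$. A subset $C$ of a semilattice is a chain if $xy\in\{x,y\}$ for all $x,y\in C$. A subsemilattice is a subset closed under the operation. A topologized semilattice is a semilattice endowed with a topology (no compatibility and no separation axiom assumed). A semitopological semilattice is a topologized semilattice $X$ whose operation $X\times X\to X$, $(x,y)\mapsto xy$, is separately continuous, i.e. for every $a\in X$ the shift $x\mapsto ax$ is continuous. A topologized semilattice $X$ is complete if each non-empty chain $C\subset X$ has an infimum $\inf C$ and a supremum $\sup C$ in the partially ordered set $(X,\le)$, and $\inf C\in\bar C$ and $\sup C\in\bar C$, where $\bar C$ is the closure of $C$ in $X$. A subsemilattice $X$ of a topologized semilattice $Y$ is called complete if $X$, endowed with the subspace topology, is a complete topologized semilattice (infima, suprema and closures being taken in $X$). A topological space $Z$ satisfies the separation axiom $T_1$ if for any distinct points $x,y\in Z$ there is an open set $U\subset Z$ with $x\in U$ and $y\notin U$. A topological space $Z$ satisfies the separation axiom $T_{2\delta}$ if $Z$ is a $T_1$-space and for any open set $U\subset Z$ and any point $x\in U$ there exists a countable family $\mathcal U$ of closed neighborhoods of $x$ in $Z$ such that $\bigcap\mathcal U\subset U$. A topological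 space $Z$ satisfies the separation axiom $\vec{T}_{2\delta}$ if $Z$ admits a bijective continuous map $Z\to W$ onto some topological space $W$ satisfying $T_{2\delta}$. *)

(* Defs.v *)
From mathcomp Require Import all_boot all_order all_algebra.
From mathcomp Require Import all_classical all_reals all_analysis.

Set Implicit Arguments.
Unset Strict Implicit.
Unset Printing Implicit Defensive.

Local Open Scope classical_set_scope.

Section Semilattice.
Context {T : Type} (op : T -> T -> T).

Definition is_semilattice : Prop :=
  [/\ associative op, commutative op & idempotent_op op].

Definition semilattice_le (x y : T) : Prop := op x y = x.

Definition semilattice_chain (C : set T) : Prop :=
  forall x y, C x -> C y -> op x y = x \/ op x y = y.

Definition semilattice_inf (C : set T) (m : T) : Prop :=
  (forall x, C x -> semilattice_le m x) /\
  (forall z, (forall x, C x -> semilattice_le z x) -> semilattice_le z m).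

Definition semilattice_sup (C : set T) (m : T) : Prop :=
  (forall x, C x -> semilattice_le x m) /\
  (forall z, (forall x, C x -> semilattice_le x z) -> semilattice_le m z).

Definition subsemilattice (X : set T) : Prop :=
  forall x y, X x -> X y -> X (op x y).

Definition sub_op (X : set T) (hX : subsemilattice X) (x y : X) : X :=
  SigSub (mem_set (hX (val x) (val y) (set_valP x) (set_valP y))).

End Semilattice.

Lemma sub_op_semilattice (T : Type) (op : T -> T -> T) (X : set T)
    (hX : subsemilattice op X) :
  is_semilattice op -> is_semilattice (sub_op hX).
Proof.
move=> [opA opC opI]; split.
- by move=> x y z; apply: val_inj; exact: opA.
- by move=> x y; apply: val_inj; exact: opC.
- by move=> x; apply: val_inj; exact: opI.
Qed.

(* Continuity of the left shifts suffices: op is commutative. *)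
Definition semitopological_semilattice (Y : topologicalType)
    (op : Y -> Y -> Y) : Prop :=
  is_semilattice op /\ forall a : Y, continuous (op a).

Definition complete_semilattice (Z : topologicalType)
    (op : Z -> Z -> Z) : Prop :=
  forall C : set Z, C !=set0 -> semilattice_chain op C ->
    (exists m, semilattice_inf op C m /\ closure C m) /\
    (exists m, semilattice_sup op C m /\ closure C m).

(* The type X : Type associated with X : set Y carries the subspace topology
   (the initial topology of the inclusion), so chains, bounds and closures
   below are all taken inside X. *)
Definition complete_subsemilattice (Y : topologicalType) (op : Y -> Y -> Y)
    (X : set Y) (hX : subsemilattice op X) : Prop :=
  @complete_semilattice (set_type X) (sub_op hX).

Definition T2delta (Z : topologicalType) : Prop :=
  accessible_space Z /\
  forall (U : set Z) (x : Z), open U -> U x ->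
    exists F : set (set Z),
      [/\ countable F,
          forall V, F V -> closed V /\ nbhs x V &
          \bigcap_(V in F) V `<=` U].

Definition vecT2delta (Z : topologicalType) : Prop :=
  exists (W : topologicalType) (f : Z -> W),
    [/\ T2delta W, continuous f & bijective f].

(* Main.v *)
Require Import Defs.
From mathcomp Require Import all_boot all_order all_algebra.
From mathcomp Require Import all_classical all_reals all_analysis.
From mathcomp Require Import wochoice.

Local Open Scope classical_set_scope.

(** Let [x] be in the closure of the complete subsemilattice [X].  The heart of
the proof is that [x] is in [X] ([complete_closed]); closedness of the order
then comes for free, by applying the same result to the order itself, which is
a complete subsemilattice of [Y * Y] ([order_closed]).

The axiom T2delta is used only through the sets [G] that are at once an
intersection of countably many closed sets and contained in the interior of
each of them ([closed_Gdelta]).  Such sets are stable under continuous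
preimages, and in a T2delta space they separate points, so they separate the
points of [Y].  It is therefore enough to find a point [s] of [X] lying in
every such [G] that contains [x]: then [s = x].

A single neighbourhood of [x] is easy to deal with: [x] is idempotent and the
shifts are continuous, so one can choose points [w_0, w_1, ...] of [X] one
after the other, near enough to [x] that all finite products of them, with or
without a factor [x], stay in the prescribed open set.  If the condition number
[n] is imposed from [w_n] on, completeness of [X] provides a lower limit
[s = sup_n inf (products of w_n, w_n+1, ...)] that satisfies all countably many
conditions, provided that open sets are replaced by closed ones.  This handles
countably many sets [G] at a time ([countable_conditions]).

To reach all sets [G] the construction is repeated transfinitely along a
well-order of them.  At stage [i] a point [w_i] of [X] is needed which,
multiplied by any product of earlier points, stays in the sets of index at most
[i].  That such a [w_i] exists is the statement to be proved, for the shorter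
initial segment below [i], so the induction hypothesis has to cover conditions
[G (a_1 ... a_n w)] with parameters [a_k] taken from sets that are countable at
each index ([solves]).  As [G] is closed, it contains the products with the
lower limit of the [w_i], which is again a solution ([solves_step]).  Because
stage [i] uses only the indices below [i], the induction is on an arbitrary
well-order and no cardinal arithmetic is involved. *)

(** * Choice and well-orders *)

Lemma countableU {T : Type} {A B : set T} :
  countable A -> countable B -> countable (A `|` B).
Proof.
move=> cA cB; have -> : A `|` B = \bigcup_(b in setT) (if b then A else B).
  apply/seteqP; split=> [t [At|Bt]|t [[] _]]; first by exists true.
  - by exists false.
  - by left.
  - by right.
by apply: bigcup_countable => // -[].
Qed.

(** Well-founded recursion in which the value at [b] is only required to satisfy
a relation with the earlier values; [t0] fills the values not yet chosen. *)
Lemma wf_dependent_choice {E T : Type} (t0 : T) {lt : E -> E -> Prop}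
    (lt_wf : well_founded lt) (P : E -> (E -> T) -> T -> Prop) :
  (forall b f g y, (forall c, lt c b -> f c = g c) -> P b f y -> P b g y) ->
  (forall b f, exists y, P b f y) ->
  exists w, forall b, P b w (w b).
Proof.
move=> Pext Pex.
have /choice[next nextP] (bf : E * (E -> T)) : exists y, P bf.1 bf.2 y.
  exact: Pex.
pose cut b (rec : forall c, lt c b -> T) c :=
  if pselect (lt c b) is left h then rec c h else t0.
pose w := Fix lt_wf (fun=> T) (fun b rec => next (b, cut b rec)).
have wE b : w b = next (b, cut b (fun c _ => w c)).
  rewrite /w Fix_eq // => c f g fg; congr (next (c, _)).
  by apply/funext => d; rewrite /cut; case: pselect.
exists w => b; rewrite [X in P b _ X]wE.
apply: Pext (nextP (b, _)) => c cb.
by rewrite /= /cut; case: pselect.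
Qed.

Lemma well_order_total {E : eqType} {R : rel E} : well_order R ->
  [/\ total R, transitive R & well_founded (fun i j => R i j && (i != j))].
Proof.
move=> Rwo.
have Rch : wo_chain R predT by move=> A _; exact: Rwo.
have Rtot : total R by move=> x y; exact: (wo_chainW Rch).
have Ranti : antisymmetric R by move=> x y; exact: (wo_chain_antisymmetric Rch).
split; [exact: Rtot| |].
- move=> y x z xy yz; have [|m [[mA mmin] _]] := Rwo [mem [:: x; y; z]].
    by exists x; rewrite !inE eqxx.
  have [mx my mz] : [/\ R m x, R m y & R m z].
    by split; apply: mmin; rewrite !inE eqxx ?orbT.
  move: mA; rewrite !inE => /or3P[] /eqP em; rewrite em in mx my mz => //.
    by rewrite (Ranti x y) // xy mx.
  by rewrite -(Ranti y z) // yz my.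
- move=> i; apply: contrapT => nacc.
  have [|m [[mA mmin] _]] :=
    Rwo [pred j | `[< ~ Acc (fun i j => R i j && (i != j)) j >]].
    by exists i; apply/asboolP.
  apply: (asboolW mA); apply: Acc_intro => j /andP[jm njm].
  apply: contrapT => nj; have mj : R m j.
    by apply: mmin; apply/asboolP.
  by rewrite (Ranti j m) ?eqxx // in njm; rewrite jm.
Qed.

(** * Chain completeness and closed G-delta sets *)

Lemma closure_sub_preimage {T U : topologicalType} (f : T -> U) (S : set T)
    (V : set U) :
  continuous f -> closed V -> (forall p, S p -> V (f p)) ->
  forall p, closure S p -> V (f p).
Proof.
move=> cf cV SV p; suff : closure S `<=` f @^-1` V by apply.
have : closed (f @^-1` V) by apply: preimage_closed.
by move=> /closure_id ->; apply: closure_subset.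
Qed.

(** Half of completeness, stated inside the ambient space and for an arbitrary
relation [r], so that one definition serves infima and suprema: for the latter,
[r] is the reverse order.  Bounds are compared with elements of [X] only. *)
Definition chain_complete {T : topologicalType} (r : T -> T -> Prop)
    (X : set T) : Prop :=
  forall C : set T, C `<=` X -> C !=set0 -> total_on C r ->
  exists m, [/\ X m, forall c, C c -> r m c,
    forall z, X z -> (forall c, C c -> r z c) -> r z m & closure C m].

(** [G] is the intersection of [F] as well as of the interiors of the members of
[F]: for countably many conditions, membership in [G] can be treated as an open
condition on input and as a closed one on output. *)
Definition closed_Gdelta {T : topologicalType} (G : set T) : Prop :=
  exists F : set (set T), [/\ countable F,
    forall V, F V -> closed V /\ G `<=` V° & \bigcap_(V in F) V `<=` G].

Definition closed_Gdelta_separated (T : topologicalType) : Prop :=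
  forall x y : T, x <> y -> exists G, [/\ closed_Gdelta G, G x & ~ G y].

(** * Finite products in a semilattice *)

Section Semilattice.
Context {Y : topologicalType} {op : Y -> Y -> Y}.
Hypothesis opY : semitopological_semilattice op.

Let opA : associative op. Proof. by case: opY => -[]. Qed.
Let opC : commutative op. Proof. by case: opY => -[]. Qed.
Let opI : idempotent_op op. Proof. by case: opY => -[]. Qed.
Let op_cont a : continuous (op a). Proof. by case: opY. Qed.
Let op_contr a : continuous (op^~ a).
Proof.
have -> : op^~ a = op a by apply/funext => y; rewrite opC.
exact: op_cont.
Qed.

Local Notation le := (semilattice_le op).
Local Notation ge := (fun x y : Y => semilattice_le op y x).

Lemma semilattice_le_trans y x z : le x y -> le y z -> le x z.
Proof. by rewrite /semilattice_le => xy yz; rewrite -xy -opA yz. Qed.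

Lemma semilattice_le_anti x y : le x y -> le y x -> x = y.
Proof. by rewrite /semilattice_le => xy; rewrite opC xy. Qed.

Lemma op_foldr a y l : op a (foldr op y l) = foldr op (op a y) l.
Proof. by elim: l => //= b l <-; rewrite !opA [op a b]opC. Qed.

Lemma foldr_op_filter {E : eqType} (w : E -> Y) m y (F : seq E) :
  foldr op (op (w m) y) (map w F) =
  foldr op (op (w m) y) (map w [seq j <- F | j != m]).
Proof.
elim: F => //= k F IH; case: eqP => [->|_] /=; last by rewrite IH.
by rewrite -IH op_foldr opA opI.
Qed.

Lemma foldr_op_mem {E : eqType} (w : E -> Y) m y (F : seq E) :
  m \in F -> foldr op (op (w m) y) (map w F) = foldr op y (map w F).
Proof.
elim: F => //= k F IH; rewrite inE => /orP[/eqP <-|/IH ->//].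
by rewrite op_foldr opA opI -op_foldr.
Qed.

Lemma foldr_op_continuous l : continuous (fun y => foldr op y l).
Proof.
elim: l => [|a l IH] /= y; first exact: cvg_id.
by apply: continuous_comp; [exact: IH|exact: op_cont].
Qed.

(** * Lower limits in a complete subsemilattice *)

Section Complete.
Context {X : set Y}.
Hypothesis X_sub : subsemilattice op X.
Hypothesis X_inf : chain_complete le X.
Hypothesis X_sup : chain_complete ge X.

Lemma closure_subsemilattice (S : set Y) :
  subsemilattice op S -> subsemilattice op (closure S).
Proof.
move=> Ssub a b Sa Sb.
apply: (closure_sub_preimage (op a) S) => //; first exact: closed_closure.
move=> c Sc; apply: (closure_sub_preimage (op^~ c) S) => //.
  exact: closed_closure.
by move=> d Sd; apply: subset_closure; exact: Ssub.
Qed.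

(** Chains in [closure S] have lower bounds there by completeness, so Zorn's
lemma gives a minimal element; as [closure S] is a subsemilattice, a minimal
element is a least one.  This is how infima of non-chains become available. *)
Lemma closure_has_least (S : set Y) :
  S !=set0 -> S `<=` X -> subsemilattice op S ->
  exists m, [/\ X m, closure S m & forall p, X p -> closure S p -> le m p].
Proof.
move=> [p0 Sp0] SX Ssub.
pose K := closure S `&` X.
have Ksub : subsemilattice op K.
  move=> a b [Sa Xa] [Sb Xb]; split; last exact: X_sub.
  exact: closure_subsemilattice.
have Kp0 : K p0 by split; [exact: subset_closure|exact: SX].
(* The reverse order, since Zorn's lemma produces maximal elements. *)
pose R (a b : {y | K y}) := `[< le (sval b) (sval a) >].
have [||||m mP] := @Zorn _ R.
- by move=> a; apply/asboolP; exact: opI.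
- move=> a b c /asboolP ab /asboolP bc; apply/asboolP.
  exact: semilattice_le_trans bc ab.
- move=> [a Ka] [b Kb] /asboolP ba /asboolP ab; apply: eq_exist => /=.
  exact: semilattice_le_anti.
- move=> A Atot; have [[a0 Aa0]|A0] := pselect (A !=set0); last first.
    by exists (exist _ p0 Kp0) => s As; case: A0; exists s.
  have [|||m [Xm mA _ clm]] := X_inf (sval @` A).
  + by move=> _ [[a [Sa Xa]] _ <-].
  + by exists (sval a0), a0.
  + move=> _ _ [a Aa <-] [b Ab <-].
    by case: (Atot a b Aa Ab) => /asboolP; [right|left].
  have Km : K m.
    split=> //; apply/closed_closure/(closure_subset _ clm).
    by move=> _ [[a [Sa Xa]] _ <-].
  by exists (exist _ m Km) => a Aa; apply/asboolP; apply: mA; exists a.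
case: m mP => m Km mP; exists m; split; [exact: Km.2|exact: Km.1|].
move=> p Xp Sp; have Kmp : K (op m p) by apply: Ksub.
(* Minimality of m against the product of m and p. *)
apply: (congr1 sval (mP (exist _ _ Kmp) _)).
by apply/asboolP; rewrite /semilattice_le /= opC opA opI.
Qed.

(** The limit [s] is the lower limit of [w]: the supremum over [i] of the least
element of the closure of the products of terms of index at least [i].  Finite
products obey [O] because the factor of largest index can be split off and
treated by the step hypothesis; closures then turn [O] into [V].

The limit does not depend on the condition, hence the quantification over
[f], [O], [V] and [i0] after that of [s].  Two uses are made of it: with
[O] the interior of [V] along the natural numbers, and with [O = V] along a
well-order. *)
Lemma stepwise_limit {E : eqType} {R : rel E} (Rtot : total R)
    (Rtrans : transitive R) (I : set E) (w : E -> Y) (x : Y) :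
  I !=set0 -> (forall i, I i -> X (w i)) ->
  exists2 s, X s & forall (f : Y -> Y) (O V : set Y) i0,
    continuous f -> closed V -> O `<=` V -> I i0 -> O (f x) ->
    (forall k (F : seq E), I k -> R i0 k ->
      (forall j, j \in F -> [/\ I j, R i0 j, R j k & j != k]) ->
      O (f (foldr op x (map w F))) ->
      O (f (foldr op (w k) (map w F))) /\
      O (f (foldr op (op (w k) x) (map w F)))) ->
    V (f s) /\ V (f (op s x)).
Proof.
move=> [e0 Ie0] wX.
pose over i (F : seq E) := forall j, j \in F -> I j /\ R i j.
(* By idempotence the seed of the fold, being in F, does not add a factor. *)
pose S i := [set p | exists k F, [/\ k \in F, over i F
                                   & p = foldr op (w k) (map w F)]].
have SX i : S i `<=` X.
  move=> _ [k [F [kF oF ->]]].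
  have : X (w k) by apply: wX; case: (oF k kF).
  elim: F (w k) oF {kF} => //= a F IH y oF Xy; apply: X_sub.
    by apply: wX; case: (oF a (mem_head _ _)).
  by apply: IH => // j jF; apply: oF; rewrite inE jF orbT.
have Ssub i : subsemilattice op (S i).
  move=> _ _ [k [F [kF oF ->]]] [k' [F' [kF' oF' ->]]].
  exists k', (F' ++ F); split; first by rewrite mem_cat kF'.
    by move=> j; rewrite mem_cat => /orP[/oF'|/oF].
  rewrite op_foldr map_cat foldr_cat [op _ (w k')]opC op_foldr.
  by rewrite [op (w k') _]opC foldr_op_mem.
have Smono i j : R i j -> S j `<=` S i.
  move=> ij _ [k [F [kF oF ->]]]; exists k, F; split=> // a /oF[Ia ja].
  by split=> //; exact: Rtrans ja.
have Rrefl i : R i i by have := Rtot i i; rewrite orbb.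
have /choice[m mP] i : exists m, I i ->
    [/\ X m, closure (S i) m & forall p, X p -> closure (S i) p -> le m p].
  have [Ii|nI] := pselect (I i); last by exists x.
  have [|||m mP] := @closure_has_least (S i) => //; last by exists m.
  exists (w i), i, [:: i]; split; rewrite ?mem_head ?opI //.
    by move=> j; rewrite inE => /eqP->.
  by rewrite /= opI.
have mmono i j : I i -> I j -> R i j -> le (m i) (m j).
  move=> Ii Ij ij; have [_ _ mi] := mP _ Ii.
  have [Xj Sj _] := mP _ Ij; apply: mi => //.
  exact: closure_subset (Smono _ _ ij) _ Sj.
pose T i0 := m @` [set i | I i /\ R i0 i].
have Tsup i0 : I i0 -> exists s, [/\ X s, forall c, T i0 c -> le c s,
    forall z, X z -> (forall c, T i0 c -> le c z) -> le s z &
    closure (T i0) s].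
  move=> Ii0; apply: X_sup.
  - by move=> _ [i [Ii _] <-]; case: (mP i Ii).
  - by exists (m i0), i0.
  - move=> _ _ [i [Ii _] <-] [j [Ij _] <-].
    by have /orP[ij|ij] := Rtot i j; [right|left]; exact: mmono.
have [s [Xs sub sleast _]] := Tsup _ Ie0.
(* A final part of an increasing chain has the same supremum. *)
have scl i0 : I i0 -> closure (T i0) s.
  move=> Ii0; have [s' [Xs' sub' sleast' cl']] := Tsup _ Ii0.
  suff -> : s = s' by [].
  apply: semilattice_le_anti.
    apply: sleast => // _ [i [Ii _] <-].
    have /orP[ij|ij] := Rtot i0 i; first by apply: sub'; exists i.
    apply: (@semilattice_le_trans (m i0)); first exact: mmono.
    by apply: sub'; exists i0.
  apply: sleast' => // _ [i [Ii _] <-].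
  have /orP[ij|ij] := Rtot e0 i; first by apply: sub; exists i.
  apply: (@semilattice_le_trans (m e0)); first exact: mmono.
  by apply: sub; exists e0.
exists s => // f O V i0 cf cV OV Ii0 Ofx step.
have prodO n (F : seq E) : (size F <= n)%N -> over i0 F ->
    O (f (foldr op x (map w F))) /\
    forall k, k \in F -> O (f (foldr op (w k) (map w F))).
  elim: n F => [|n IH] F; first by case: F.
  have [->//|Fne] := eqVneq F [::].
  move=> Fn oF.
  have [k kF kmax] : exists2 k, k \in F & forall j, j \in F -> R j k.
    elim: F Fne {Fn oF} => // a F IHF _.
    have [->|/IHF[k kF kmax]] := eqVneq F [::].
      by exists a; rewrite ?mem_head// => j; rewrite inE => /eqP->.
    have /orP[ak|ka] := Rtot a k.
      exists k; first by rewrite inE kF orbT.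
      by move=> j; rewrite inE => /orP[/eqP->//|/kmax].
    exists a; rewrite ?mem_head// => j; rewrite inE => /orP[/eqP->//|/kmax jk].
    exact: Rtrans ka.
  pose F' := [seq j <- F | j != k].
  have F'F j : j \in F' -> j \in F by rewrite mem_filter => /andP[].
  have [Ik i0k] := oF _ kF.
  have [||O1 O2] := IH F'.
  - rewrite -ltnS; apply: leq_trans Fn; rewrite size_filter.
    rewrite -[ltnRHS](count_predC (pred1 k)) -[ltnLHS]add0n ltn_add2r.
    by rewrite -has_count has_pred1.
  - by move=> j /F'F /oF.
  have [|] := step k F' Ik i0k _ O1.
    move=> j jF'; have [Ij i0j] := oF j (F'F _ jF'); split=> //.
      by apply: kmax; exact: F'F.
    by move: jF'; rewrite mem_filter => /andP[].
  move=> H1 H2; split.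
    by rewrite -(foldr_op_mem _ _ _ _ kF) foldr_op_filter.
  move=> j jF; rewrite -(foldr_op_mem _ _ _ _ kF) foldr_op_filter -/F'.
  have [->|jk] := eqVneq j k; first by rewrite opI.
  by rewrite opC foldr_op_mem // mem_filter jk.
have TV (g : Y -> Y) : continuous g -> (forall p, S i0 p -> V (g p)) -> V (g s).
  move=> cg SV; apply: (closure_sub_preimage g (T i0)) (scl _ Ii0) => //.
  move=> _ [i [Ii i0i] <-]; apply: (closure_sub_preimage g (S i0)) => //.
  by have [_ + _] := mP i Ii; apply: closure_subset; exact: Smono.
split; [apply: (TV f)|apply: (TV (f \o op^~ x))] => //.
- by move=> _ [k [F [kF oF ->]]]; apply: OV; exact: (prodO _ _ (leqnn _) oF).2.
- by move=> y; apply: continuous_comp; [exact: op_contr|exact: cf].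
- move=> _ [k [F [kF oF ->]]]; apply: OV.
  rewrite /= opC op_foldr opC foldr_op_mem //.
  exact: (prodO _ _ (leqnn _) oF).1.
Qed.

(** Infinitely many lists are involved, but repetitions are harmless: removing
from [l] all copies of one parameter [a] amounts to replacing [f] by
[f \o op a], and the parameters are finitely many.  With no parameter left, the
claim is continuity at the idempotent [x]. *)
Lemma finite_products_near (x : Y) (s : seq Y) (f : Y -> Y) (O : set Y) :
  continuous f -> open O ->
  \forall y \near x, forall l : seq Y, {subset l <= s} ->
    O (f (foldr op x l)) ->
    O (f (foldr op y l)) /\ O (f (foldr op (op y x) l)).
Proof.
move=> + oO; elim: s f => [|a s IH] f cf.
  have [Ofx|nO] := pselect (O (f x)); last first.
    by apply: nearW => y [|b l] //= /(_ b); rewrite mem_head => /(_ isT).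
  have N1 : nbhs x (f @^-1` O) by apply: cf; exact: open_nbhs_nbhs.
  have N2 : nbhs x ((f \o op^~ x) @^-1` O).
    apply: (@continuous_comp _ _ _ (op^~ x) f x).
    - exact: op_contr.
    - exact: cf.
    - by rewrite /= opI; exact: open_nbhs_nbhs.
  near=> y => -[|b l]; last by move=> /(_ b); rewrite mem_head => /(_ isT).
  move=> _ _ /=; split; first by near: y.
  by near: y.
have cfa : continuous (f \o op a).
  by move=> y; apply: continuous_comp; [exact: op_cont|exact: cf].
near=> y => l ls.
have [al|al] := boolP (a \in l); last first.
  have : forall l, {subset l <= s} -> O (f (foldr op x l)) ->
    O (f (foldr op y l)) /\ O (f (foldr op (op y x) l)) by near: y; exact: IH.
  apply=> b bl; have := ls b bl; rewrite inE => /orP[/eqP ba|//].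
  by rewrite -ba bl in al.
have E z : foldr op z l = op a (foldr op z [seq j <- l | j != a]).
  rewrite op_foldr -[l in LHS]map_id -(foldr_op_mem id a _ _ al).
  by rewrite foldr_op_filter map_id.
rewrite !E.
have : forall l, {subset l <= s} -> O ((f \o op a) (foldr op x l)) ->
    O ((f \o op a) (foldr op y l)) /\ O ((f \o op a) (foldr op (op y x) l)).
  by near: y; exact: IH.
apply=> b; rewrite mem_filter => /andP[ba /ls].
by rewrite inE (negbTE ba).
Unshelve. all: by end_near. Qed.

(** * Solving conditions near a point of the closure *)

Section Closure.
Context {x : Y}.
Hypothesis clXx : closure X x.

(** At step [k] the conditions numbered up to [k] are open and finitely many,
so a point of [X] close to [x] keeps them true for its products with the
previous points; [stepwise_limit] concludes. *)
Lemma countable_conditions (cond : set (seq Y * set Y)) :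
  countable cond ->
  (forall c, cond c -> closed c.2 /\ (c.2)° (foldr op x c.1)) ->
  exists2 s, X s & forall c, cond c ->
    c.2 (foldr op s c.1) /\ c.2 (foldr op (op s x) c.1).
Proof.
move=> /countable_injP[r rinj] condP.
(* An enumeration with junk values outside the range of r, hence the guard. *)
have /choice[e eP] n : exists c, (exists2 c', cond c' & r c' = n) ->
    cond c /\ r c = n.
  have [[c cc rc]|no] := pselect (exists2 c', cond c' & r c' = n).
    by exists c.
  by exists ([::], set0) => /no.
pose P k (w : nat -> Y) y := X y /\ forall n (l : seq Y), (n <= k)%N ->
  {subset l <= map w (iota 0 k)} ->
  ((e n).2)° (foldr op (foldr op x l) (e n).1) ->
  ((e n).2)° (foldr op (foldr op y l) (e n).1) /\
  ((e n).2)° (foldr op (foldr op (op y x) l) (e n).1).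
have ltn_wf : well_founded (fun i j => (i < j)%N).
  by move=> i; elim/ltn_ind: i => i IH; constructor=> j /IH.
have [||w wP] := @wf_dependent_choice nat Y x _ ltn_wf P.
- move=> k v w y vw [Xy yP]; split=> // n l nk lw.
  apply: yP => //; suff -> : map v (iota 0 k) = map w (iota 0 k) by [].
  by apply/eq_in_map => i; rewrite mem_iota => /vw.
- move=> k w.
  have near_k : \forall y \near x, forall n, (n < k.+1)%N ->
      forall l : seq Y, {subset l <= map w (iota 0 k)} ->
      ((e n).2)° (foldr op (foldr op x l) (e n).1) ->
      ((e n).2)° (foldr op (foldr op y l) (e n).1) /\
      ((e n).2)° (foldr op (foldr op (op y x) l) (e n).1).
    elim: k.+1 => [|K IH]; first exact: nearW.
    near=> y => n; rewrite ltnS leq_eqVlt => /orP[/eqP->|].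
      near: y; apply: (finite_products_near x _ (fun z => foldr op z (e K).1)).
        exact: foldr_op_continuous.
      exact: open_interior.
    by move: n; near: y.
  have [y [Xy yP]] := clXx _ near_k.
  by exists y; split=> // n l nk; exact: yP.
have [||s Xs sP] := @stepwise_limit nat leq leq_total leq_trans
  setT w x.
- by exists 0%N.
- by move=> i _; have [] := wP i.
exists s => // c cc; have [cl cx] := condP c cc.
have ec : e (r c) = c.
  have [|ce er] := eP (r c); first by exists c.
  by apply: rinj; rewrite ?inE.
apply: (sP (fun z => foldr op z c.1) (c.2)° c.2 (r c)) => //.
- exact: foldr_op_continuous.
- exact: interior_subset.
- move=> k F _ rk Fk; have [_ /(_ (r c) (map w F) rk)] := wP k.
  rewrite ec; apply=> _ /mapP[j jF ->]; apply: map_f.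
  have [_ _ jk jnk] := Fk j jF.
  by rewrite mem_iota add0n ltn_neqAle jnk.
Unshelve. all: by end_near. Qed.

(** The form of the existence statement that supports transfinite induction on
[I]: the data attached to the indices vary freely, since a stage of the
construction adds its own points to [H] and moves the sets of its own index
into [H0] and [C0]. *)
Definition solves {E : Type} (I : set E) : Prop :=
  forall (H0 : set Y) (H : E -> set Y) (C0 : set (set Y)) (C : E -> set Y),
  countable H0 -> (forall i, countable (H i)) -> countable C0 ->
  (forall G, C0 G -> closed_Gdelta G) -> (forall i, closed_Gdelta (C i)) ->
  exists2 s, X s & forall (l : seq Y) (G : set Y),
    (forall a, a \in l -> (H0 `|` \bigcup_(i in I) H i) a) ->
    (C0 `|` C @` I) G -> G (foldr op x l) ->
    G (foldr op s l) /\ G (foldr op (op s x) l).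

(** Only countably many lists of parameters and countably many closed sets are
involved, and [G (foldr op x l)] puts [foldr op x l] in their interiors. *)
Lemma solves0 {E : Type} : @solves E set0.
Proof.
move=> H0 H C0 C cH0 _ cC0 GC0 _.
have /choice[F FP] G : exists F : set (set Y), C0 G -> [/\ countable F,
    forall V, F V -> closed V /\ G `<=` V° & \bigcap_(V in F) V `<=` G].
  have [/GC0[F FP]|nG] := pselect (C0 G); first by exists F.
  by exists set0.
pose L := [set l : seq Y | forall a, a \in l -> H0 a].
have cL : countable L.
  have /countable_injP[r rinj] := cH0.
  apply/countable_injP; exists (fun l => pickle (map r l)) => l l'.
  rewrite !inE => Ll Ll' /(pcan_inj pickleK).
  elim: l l' Ll Ll' => [|a l IH] [|b l'] //= Ll Ll' [ab ll].
  congr (_ :: _).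
    by apply: rinj ab; rewrite inE; [apply: Ll|apply: Ll']; rewrite mem_head.
  by apply: IH => // c cl; [apply: Ll|apply: Ll']; rewrite inE cl orbT.
pose cond := [set c | (L `*` \bigcup_(G in C0) F G) c /\
                      (c.2)° (foldr op x c.1)].
have [||s Xs sP] := @countable_conditions cond.
- apply: (@sub_countable _ _ _ (L `*` \bigcup_(G in C0) F G)).
    by apply: subset_card_le => c [].
  apply: countableX => //; apply: bigcup_countable => //.
  by move=> G CG; have [] := FP G CG.
- by move=> [l V] /= [[_ [G /FP[_ FG _] /FG[]]]].
exists s => // l G lH [GC|[i []]].
have [_ FG GF] := FP G GC => Gx.
have lL : L l by move=> a /lH[//|[i []]].
have sl V : F G V -> V (foldr op s l) /\ V (foldr op (op s x) l).
  move=> FV; apply: (sP (l, V)); split; last by have [_] := FG V FV; apply.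
  by split=> //; exists G.
by split; apply: GF => V FV; have [] := sl V FV.
Qed.

(** The point [w k] solves the conditions of index at most [k] for parameters of
index at most [k] together with the points [w i] for [i] below [k].  A given
list [l] and a given [G] involve finitely many indices, so from some [i0] on
they belong to what the points of the sequence were required to solve, and
[stepwise_limit] applies with [O = V = G]. *)
Lemma solves_step {E : eqType} {R : rel E} (Rtot : total R)
    (Rtrans : transitive R)
    (Rwf : well_founded (fun i j => R i j && (i != j))) (I : set E) :
  (forall i, I i -> solves [set j | R j i && (j != i)]) -> solves I.
Proof.
move=> IH.
have [Ine|/set0P/negP/negPn/eqP ->] := pselect (I !=set0); last exact: solves0.
move=> H0 H C0 C cH0 cH cC0 GC0 GC.
pose lt i := [set j | R j i && (j != i)].
pose P k (w : E -> Y) y := I k -> X y /\ forall (l : seq Y) (G : set Y),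
  (forall a, a \in l ->
    ((H0 `|` H k) `|` \bigcup_(i in lt k) (H i `|` [set w i])) a) ->
  ((C0 `|` [set C k]) `|` C @` lt k) G -> G (foldr op x l) ->
  G (foldr op y l) /\ G (foldr op (op y x) l).
have [||w wP] := @wf_dependent_choice E Y x _ Rwf P.
- move=> k v w y vw + Ik => /(_ Ik)[Xy yP]; split=> // l G lP; apply: yP.
  move=> a /lP[|[i ik [|aw]]]; first by left.
    by right; exists i => //; left.
  by right; exists i => //; right; rewrite vw.
- move=> k w; have [Ik|nI] := pselect (I k); last by exists x => /nI.
  have [|||||s Xs sP] := IH k Ik (H0 `|` H k) (fun i => H i `|` [set w i])
    (C0 `|` [set C k]) C.
  + exact: countableU.
  + by move=> i; exact: countableU.
  + exact: countableU.
  + by move=> G [/GC0//|->].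
  + by [].
  by exists s.
have [||s Xs sP] := @stepwise_limit E R Rtot Rtrans I w x.
- by [].
- by move=> i Ii; have [] := wP i Ii.
have Rrefl i : R i i by have := Rtot i i; rewrite orbb.
exists s => // l G lH GCI Gx.
pose low i := [set j | R j i].
have [i1 Ii1 lH1] : exists2 i, I i &
    forall a, a \in l -> (H0 `|` \bigcup_(j in low i) H j) a.
  elim: l lH {Gx} => [|a l IHl] lH; first by have [i Ii] := Ine; exists i.
  have [b bl|i Ii iP] := IHl; first by apply: lH; rewrite inE bl orbT.
  have [aH0|[j Ij aj]] := lH a (mem_head _ _).
    exists i => // b; rewrite inE => /orP[/eqP->|]; [by left|exact: iP].
  have /orP[ij|ji] := Rtot i j.
    exists j => // b; rewrite inE => /orP[/eqP->|/iP[|[k ki bk]]].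
    - by right; exists j => //; exact: Rrefl.
    - by left.
    - by right; exists k => //; exact: Rtrans ij.
  exists i => // b; rewrite inE => /orP[/eqP->|/iP//].
  by right; exists j.
have [i0 [Ii0 lH0 GC0']] : exists i, [/\ I i,
    forall a, a \in l -> (H0 `|` \bigcup_(j in low i) H j) a &
    (C0 `|` C @` low i) G].
  case: GCI => [CG|[j Ij CG]]; first by exists i1; split=> //; left.
  have /orP[ij|ji] := Rtot i1 j.
    exists j; split=> //; last by right; exists j => //; exact: Rrefl.
    move=> a /lH1[|[k ki ak]]; first by left.
    by right; exists k => //; exact: Rtrans ij.
  by exists i1; split=> //; right; exists j.
have clG : closed G.
  have [F [_ FG GF]] : closed_Gdelta G.
    by case: GCI => [/GC0|[j _ <-]].
  have -> : G = \bigcap_(V in F) V.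
    apply/seteqP; split=> // y Gy V FV.
    by apply: interior_subset; have [_] := FG V FV; apply.
  by apply: closed_bigI => V /FG[].
apply: (sP (fun z => foldr op z l) G G i0) => //.
  exact: foldr_op_continuous.
have low_lt k i : R i0 k -> low i0 i -> i = k \/ lt k i.
  move=> ik ii; have [->|ne] := eqVneq i k; first by left.
  by right; rewrite /lt/= ne andbT; exact: Rtrans ik.
move=> k F Ik ik Fk; rewrite -!foldr_cat.
have [_] := wP k Ik; apply.
- move=> a; rewrite mem_cat => /orP[/lH0[|[i ii ai]]|/mapP[i iF ->]].
  + by left; left.
  + have [<-|ltki] := low_lt k i ik ii; first by left; right.
    by right; exists i => //; left.
  + have [_ _ Rik nik] := Fk i iF.
    by right; exists i; [rewrite /lt/= Rik|right].
- case: GC0' => [|[i ii <-]]; first by left; left.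
  have [<-|ltki] := low_lt k i ik ii; first by left; right.
  by right; exists i.
Qed.

Lemma solves_all {E : choiceType} : solves [set: E].
Proof.
have [R /well_order_total[Rtot Rtrans Rwf]] := well_ordering_principle E.
apply: (solves_step Rtot Rtrans Rwf) => i _.
elim/(well_founded_ind Rwf): i => i IH.
by apply: (solves_step Rtot Rtrans Rwf) => j; exact: IH.
Qed.

End Closure.

(** All closed G-delta sets at once are taken as conditions, indexed by [set Y]
itself with the other indices sent to [setT].  For the empty list of parameters
a condition reads: [G x] implies [G s]. *)
Lemma complete_closed : closed_Gdelta_separated Y -> closed X.
Proof.
move=> sepY x clx.
pose C (G : set Y) := if pselect (closed_Gdelta G) then G else setT.
have [|||||s Xs sP] := @solves_all x clx (set Y) set0 (fun=> set0) set0 C.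
1-4: by [].
  move=> G; rewrite /C; case: pselect => [dG|nG] //=.
  by exists set0; split.
suff -> : x = s by [].
apply: contrapT => xs; have [G [dG Gx nGs]] := sepY x s xs.
have [||| Gs _] := sP [::] G => //=.
by right; exists G => //; rewrite /C; case: pselect.
Qed.

End Complete.
End Semilattice.

(** * Closed G-delta sets separate points *)

Lemma closed_Gdelta_preimage {T U : topologicalType} (f : T -> U) (G : set U) :
  continuous f -> closed_Gdelta G -> closed_Gdelta (f @^-1` G).
Proof.
move=> cf [F [cF FG GF]]; exists (preimage f @` F); split.
- exact: sub_countable (card_image_le _ _) cF.
- move=> _ [V FV <-]; have [clV GV] := FG V FV; split.
    exact: preimage_closed.
  by move=> t /GV Vt; exact: cf.
- by move=> t Ft; apply: GF => V FV; apply: (Ft (f @^-1` V)); exists V.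
Qed.

Lemma closed_Gdelta_separated_inj {T U : topologicalType} (f : T -> U) :
  continuous f -> injective f -> closed_Gdelta_separated U ->
  closed_Gdelta_separated T.
Proof.
move=> cf fI sepU x y xy; have [|G [dG Gx nGy]] := sepU (f x) (f y).
  by move/fI.
by exists (f @^-1` G); split=> //; exact: closed_Gdelta_preimage.
Qed.

Lemma closed_Gdelta_separated_prod {T U : topologicalType} :
  closed_Gdelta_separated T -> closed_Gdelta_separated U ->
  closed_Gdelta_separated (T * U)%type.
Proof.
move=> sepT sepU [x1 x2] [y1 y2] xy.
have [e1|/sepT[G [dG Gx nGy]]] := pselect (x1 = y1); last first.
  exists (fst @^-1` G); split=> //; apply: closed_Gdelta_preimage => //.
  by move=> p; exact: cvg_fst.
have [|G [dG Gx nGy]] := sepU x2 y2.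
  by move=> e2; apply: xy; rewrite e1 e2.
exists (snd @^-1` G); split=> //; apply: closed_Gdelta_preimage => //.
by move=> p; exact: cvg_snd.
Qed.

(** Given an open [U] around [x], the axiom yields countably many closed
neighbourhoods of [x] with intersection in [U], but that intersection need not
be inside their interiors.  Applying the axiom to each of these interiors in
turn, and iterating countably often, gives a family closed under this
operation. *)
Lemma T2delta_separated {W : topologicalType} :
  T2delta W -> closed_Gdelta_separated W.
Proof.
move=> [T1 delta] x y xy; have [U [oU Ux Uy]] := T1 x y (introN eqP xy).
rewrite !inE in Ux Uy.
have /choice[Phi PhiP] V : exists F : set (set W), nbhs x V ->
    [/\ countable F, forall V', F V' -> closed V' /\ nbhs x V' &
      \bigcap_(V' in F) V' `<=` V°].
  have [nV|nV] := pselect (nbhs x V); last by exists set0.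
  have [|F FP] := delta V° x (open_interior _); first exact: nV.
  by exists F.
pose F := fix F n := if n is m.+1 then \bigcup_(V in F m) Phi V else Phi U.
have nU : nbhs x U by exact: open_nbhs_nbhs.
have FP n : countable (F n) /\ forall V, F n V -> closed V /\ nbhs x V.
  elim: n => [|n [cF nF]]; first by have [] := PhiP U nU.
  split=> [|V [V0 /nF[_ nV0]]].
    apply: bigcup_countable => // V /nF[_ nV].
    by have [] := PhiP V nV.
  by have [_ + _] := PhiP V0 nV0; exact.
exists (\bigcap_(V in \bigcup_n F n) V); split.
- exists (\bigcup_n F n); split=> //.
    by apply: bigcup_countable => // n _; have [] := FP n.
  move=> V [n _ FV]; have [clV nV] := (FP n).2 V FV; split=> //.
  have [_ _ PV] := PhiP V nV; move=> z zF; apply: PV => V' PV'.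
  by apply: zF; exists n.+1 => //; exists V.
- by move=> V [n _ FV]; have [_ /nbhs_singleton] := (FP n).2 V FV.
- move=> yF; apply: Uy; have [_ _ PU] := PhiP U nU.
  apply: interior_subset; apply: PU => V PV.
  by apply: yF; exists 0%N.
Qed.

(** * The order as a complete subsemilattice of the square *)

Definition prod_op {Y : Type} (op : Y -> Y -> Y) (p q : Y * Y) : Y * Y :=
  (op p.1 q.1, op p.2 q.2).

Lemma prod_op_semitopological {Y : topologicalType} {op : Y -> Y -> Y} :
  semitopological_semilattice op -> semitopological_semilattice (prod_op op).
Proof.
move=> -[[opA opC opI] cop]; split; first split.
- by move=> p q r; rewrite /prod_op /= !opA.
- by move=> p q; rewrite /prod_op opC [op p.2 _]opC.
- by move=> [p q]; rewrite /prod_op /= !opI.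
move=> a p; apply: cvg_pair => /=.
  by apply: continuous_comp; [exact: cvg_fst|exact: cop].
by apply: continuous_comp; [exact: cvg_snd|exact: cop].
Qed.

(** Completeness makes a chain converge to its infimum [m], not merely cluster
at it: if its elements outside [O] went down indefinitely, they would form a
chain with the same infimum [m], whose closure would contain [m].  Convergence
is what allows two coordinates to be handled simultaneously. *)
Lemma chain_eventually {T U : topologicalType} {r : T -> T -> Prop}
    {r' : U -> U -> Prop} {X : set T} {f : U -> T} {C : set U} {m : T} :
  (forall a b c, r a b -> r b c -> r a c) ->
  (forall a b, r a b -> r b a -> a = b) ->
  (forall p q, r' p q -> r (f p) (f q)) ->
  chain_complete r X -> (forall c, C c -> X (f c)) -> total_on C r' ->
  X m -> (forall c, C c -> r m (f c)) ->
  (forall z, X z -> (forall c, C c -> r z (f c)) -> r z m) ->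
  forall O, nbhs m O -> C !=set0 ->
  exists2 c, C c & forall d, C d -> r' d c -> O (f d).
Proof.
move=> rtrans ranti fmono rX CX Ctot Xm mC mgreatest O nO [c0 Cc0].
apply: contrapT => /forall2NP noc.
have {}noc c : C c -> exists d, [/\ C d, r' d c & ~ O (f d)].
  case: (noc c) => // nc _; apply: contrapT => nd; apply: nc => d Cd dc.
  by apply: contrapT => nO'; apply: nd; exists d.
pose D := [set d | C d /\ ~ O (f d)].
have [|||d [Xd dD dgreatest cld]] := rX (f @` D).
- by move=> _ [d [Cd _] <-]; exact: CX.
- by have [d [Cd _ nd]] := noc c0 Cc0; exists (f d), d.
- move=> _ _ [a [Ca _] <-] [b [Cb _] <-].
  by have [ab|ba] := Ctot a b Ca Cb; [left|right]; exact: fmono.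
have dm : d = m.
  apply: ranti.
    apply: mgreatest => // c Cc; have [e [Ce ec ne]] := noc c Cc.
    by apply: (rtrans _ (f e)); [apply: dD; exists e|exact: fmono].
  by apply: dgreatest => // _ [c [Cc _] <-]; exact: mC.
rewrite dm in cld; have [_ [[c [_ nOc] <-]]] := cld O nO.
exact: nOc.
Qed.

(** Infima are computed coordinatewise; each coordinate of a chain converges, so
the chain converges in the product.  That the coordinatewise infimum stays in
[P] is left as a hypothesis: for the order of a semilattice the reason differs
between infima and suprema. *)
Lemma chain_complete_prod {T : topologicalType} {r : T -> T -> Prop}
    {r' : T * T -> T * T -> Prop} {X : set T} {P : set (T * T)} :
  (forall a b c, r a b -> r b c -> r a c) ->
  (forall a b, r a b -> r b a -> a = b) ->
  (forall p q, r' p q <-> r p.1 q.1 /\ r p.2 q.2) ->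
  P `<=` X `*` X ->
  (forall (C : set (T * T)) m1 m2, C `<=` P -> X m1 -> X m2 ->
    (forall c, C c -> r m1 c.1 /\ r m2 c.2) ->
    (forall z, X z -> (forall c, C c -> r z c.1) -> r z m1) ->
    (forall z, X z -> (forall c, C c -> r z c.2) -> r z m2) -> P (m1, m2)) ->
  chain_complete r X -> chain_complete r' P.
Proof.
move=> rtrans ranti r'E PX PC rX C CP [c0 Cc0] Ctot.
have C0 : C !=set0 by exists c0.
have CX1 c : C c -> X c.1 by move=> /CP/PX[].
have CX2 c : C c -> X c.2 by move=> /CP/PX[].
have inf (f : T * T -> T) : (forall c, C c -> X (f c)) ->
    (forall p q, r' p q -> r (f p) (f q)) ->
    exists m, [/\ X m, forall c, C c -> r m (f c) &
      forall z, X z -> (forall c, C c -> r z (f c)) -> r z m].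
  move=> CX fmono; have [|||m [Xm mC mgreatest _]] := rX (f @` C).
  - by move=> _ [c Cc <-]; exact: CX.
  - by exists (f c0), c0.
  - move=> _ _ [a Ca <-] [b Cb <-].
    by have [ab|ba] := Ctot a b Ca Cb; [left|right]; exact: fmono.
  exists m; split=> // [c Cc|z Xz zC]; first by apply: mC; exists c.
  by apply: mgreatest => // _ [c Cc <-]; exact: zC.
have mono1 p q : r' p q -> r p.1 q.1 by move=> /r'E[].
have mono2 p q : r' p q -> r p.2 q.2 by move=> /r'E[].
have [m1 [Xm1 m1C m1greatest]] := inf fst CX1 mono1.
have [m2 [Xm2 m2C m2greatest]] := inf snd CX2 mono2.
exists (m1, m2); split.
- apply: (PC C) => // c Cc; split; [exact: m1C|exact: m2C].
- by move=> c Cc; apply/r'E; split; [exact: m1C|exact: m2C].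
- move=> z /PX[Xz1 Xz2] zC; apply/r'E; split.
    by apply: m1greatest => // c /zC/r'E[].
  by apply: m2greatest => // c /zC/r'E[].
move=> B [[A1 A2] /= [nA1 nA2] A12].
have [c1 Cc1 c1P] := chain_eventually rtrans ranti mono1 rX CX1 Ctot Xm1 m1C
  m1greatest A1 nA1 C0.
have [c2 Cc2 c2P] := chain_eventually rtrans ranti mono2 rX CX2 Ctot Xm2 m2C
  m2greatest A2 nA2 C0.
have r'refl c : C c -> r' c c by move=> Cc; have [] := Ctot c c Cc Cc.
have [c12|c21] := Ctot c1 c2 Cc1 Cc2.
  by exists c1; split=> //; apply: A12; split; [apply: c1P|apply: c2P]; auto.
by exists c2; split=> //; apply: A12; split; [apply: c1P|apply: c2P]; auto.
Qed.

Lemma order_closed {Y : topologicalType} {op : Y -> Y -> Y} {X : set Y} :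
  semitopological_semilattice op -> closed_Gdelta_separated Y ->
  subsemilattice op X -> chain_complete (semilattice_le op) X ->
  chain_complete (fun x y => semilattice_le op y x) X ->
  closed [set p : Y * Y | X p.1 /\ X p.2 /\ semilattice_le op p.1 p.2].
Proof.
move=> opY sepY X_sub X_inf X_sup; set P := [set p | _].
have sepYY := closed_Gdelta_separated_prod sepY sepY.
have letrans := @semilattice_le_trans _ _ opY.
have leanti := @semilattice_le_anti _ _ opY.
have leE p q : semilattice_le (prod_op op) p q <->
    semilattice_le op p.1 q.1 /\ semilattice_le op p.2 q.2.
  by case: p q => [p1 p2] [q1 q2]; split=> [[]|[/= e1 e2]] //; congr (_, _).
have PX : P `<=` X `*` X by move=> p [Xp [Xq _]].
apply: (complete_closed (prod_op_semitopological opY)) => //.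
- move=> p q [Xp1 [Xp2 p12]] [Xq1 [Xq2 q12]]; split; first exact: X_sub.
  split; first exact: X_sub.
  have [[opA opC _] _] := opY; rewrite /semilattice_le /=.
  by rewrite -opA [op q.1 _]opC -opA [op q.2 _]opC q12 opA p12.
- apply: (chain_complete_prod _ _ leE PX _ X_inf) => //.
    by move=> a b c; exact: letrans.
  move=> C m1 m2 CP Xm1 Xm2 mC _ m2greatest; split=> //; split=> //=.
  apply: m2greatest => // c Cc; have [m1c _] := mC c Cc.
  by apply: letrans m1c _; have [_ []] := CP c Cc.
- apply: (chain_complete_prod (r := fun x y => semilattice_le op y x) _ _ _
    PX _ X_sup).
  + by move=> a b c ba cb; exact: letrans cb ba.
  + by move=> a b ab ba; exact: leanti.
  + by move=> p q; exact: leE.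
  move=> C m1 m2 CP Xm1 Xm2 mC m1least _; split=> //; split=> //=.
  apply: m1least => // c Cc; have [_ cm2] := mC c Cc.
  by apply: letrans cm2; have [_ []] := CP c Cc.
Qed.

(** By continuity of the inclusion, a point in the closure of a chain for the
subspace topology is in its closure for the ambient one. *)
Lemma complete_subsemilattice_chain_complete {Y : topologicalType}
    {op : Y -> Y -> Y} {X : set Y} {hX : subsemilattice op X} :
  commutative op -> complete_subsemilattice hX ->
  chain_complete (semilattice_le op) X /\
  chain_complete (fun x y => semilattice_le op y x) X.
Proof.
move=> opC cX.
have val_closure (C : set Y) (m : X) :
    closure (val @^-1` C : set X) m -> closure C (val m).
  apply: (@closure_sub_preimage (set_type X) Y val).
  - exact: initial_continuous.
  - exact: closed_closure.
  by move=> p Cp; exact: subset_closure.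
pose in_X c (Xc : X c) : X := SigSub (mem_set Xc).
have half (C : set Y) : C `<=` X -> C !=set0 ->
    (forall x y, C x -> C y -> op x y = x \/ op x y = y) ->
    (exists m : X, semilattice_inf (sub_op hX) (val @^-1` C) m /\
                   closure (val @^-1` C : set X) m) /\
    (exists m : X, semilattice_sup (sub_op hX) (val @^-1` C) m /\
                   closure (val @^-1` C : set X) m).
  move=> CX [c Cc] Ctot; apply: cX.
    by exists (in_X c (CX c Cc)).
  move=> a b Ca Cb.
  by case: (Ctot _ _ Ca Cb) => e; [left|right]; exact: val_inj.
split=> C CX C0 Ctot.
- have [|[m [[mC mgreatest] clm]] _] := half C CX C0.
    move=> a b Ca Cb; case: (Ctot a b Ca Cb) => e; first by left.
    by right; rewrite opC.
  exists (val m); split; [exact: set_valP| | |exact: val_closure].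
    by move=> c Cc; exact (congr1 val (mC (in_X c (CX c Cc)) Cc)).
  move=> z Xz zC; refine (congr1 val (mgreatest (in_X z Xz) _)).
  by move=> c Cc; apply: val_inj; exact: zC.
- have [|_ [m [[mC mleast] clm]]] := half C CX C0.
    move=> a b Ca Cb; case: (Ctot a b Ca Cb) => e; last by left.
    by right; rewrite opC.
  exists (val m); split; [exact: set_valP| | |exact: val_closure].
    by move=> c Cc; exact (congr1 val (mC (in_X c (CX c Cc)) Cc)).
  move=> z Xz zC; refine (congr1 val (mleast (in_X z Xz) _)).
  by move=> c Cc; apply: val_inj; exact: zC.
Qed.

Theorem theorem7 (Y : topologicalType) (op : Y -> Y -> Y)
    (hY : semitopological_semilattice op) (hT : vecT2delta Y)
    (X : set Y) (hX : subsemilattice op X)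
    (cX : complete_subsemilattice hX) :
  closed [set p : Y * Y | X p.1 /\ X p.2 /\ semilattice_le op p.1 p.2] /\
  closed X.
Proof.
have sepY : closed_Gdelta_separated Y.
  have [W [f [T2W cf /bij_inj fI]]] := hT.
  exact: (closed_Gdelta_separated_inj f cf fI (T2delta_separated T2W)).
have [[_ opC _] _] := hY.
have [X_inf X_sup] := complete_subsemilattice_chain_complete opC cX.
split; first exact: order_closed.
exact: (complete_closed hY).
Qed.
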